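(* Let $n$ be an odd positive integer. Then the greatest length of a snake path in the king graph of size $n \times n$ is $(n^2 - 1)/2$.
   Context: A cell is a point of $\mathbb{Z}^2$. The king graph of size $n \times n$ has vertex set $[0;n-1]^2$, two distinct cells $(x',y'),(x'',y'')$ being adjacent iff $|x'-x''| \le 1$ and $|y'-y''| \le 1$. A snake path in a graph $G$ is a path in $G$ which is an induced subgraph of $G$. The length of a path is its number of edges. *)

(* Defs.v *)
From mathcomp Require Import all_boot all_algebra.

Set Implicit Arguments.
Unset Strict Implicit.
Unset Printing Implicit Defensive.

(* Graphs are adjacency relations; a path is given by the sequence of its     *)
(* vertices in order, so a one-vertex path is [:: x] and has no edges.        *)

Section Paths.
Variables (T : eqType) (adj : rel T).
Implicit Type s : seq T.

(* Each edge is listed once, oriented along the path. *)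
Definition path_edges s : seq (T * T) := zip s (behead s).

Definition path_adj s : rel T :=
  [rel u v | ((u, v) \in path_edges s) || ((v, u) \in path_edges s)].

Definition path_length s : nat := size (path_edges s).

Definition is_path s : bool :=
  if s is x :: s' then path adj x s' && uniq s else false.

(* The path is the whole subgraph induced on its vertex set. *)
Definition snake_path s : Prop :=
  is_path s /\ {in s &, forall u v, adj u v = path_adj s u v}.

End Paths.

(* `|a - b|%N is the absolute value of the difference taken in int. *)
Definition king (n : nat) : rel ('I_n * 'I_n) :=
  [rel u v : 'I_n * 'I_n | [&& u != v,
      (`|(u.1 : nat) - (v.1 : nat)| <= 1)%N
    & (`|(u.2 : nat) - (v.2 : nat)| <= 1)%N]].

Arguments king n u v : clear implicits.

Definition is_greatest (P : nat -> Prop) (m : nat) : Prop :=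
  P m /\ forall k, P k -> k <= m.

(* Main.v *)
Require Import Defs.
From mathcomp Require Import all_boot all_algebra.
From mathcomp Require Import zify.

(* Upper bound.  On the cells of a snake path every 2x2 window holds at most
   two cells and every cell has at most two neighbours; these two conditions
   alone bound the number of edges by (n^2 - 1)/2.  Peel off a frame of width
   two and induct from n - 4 to n: at most 4n - 8 edges touch the frame.  To see
   this, walk around the frame with a strip of three cells as the moving front
   and balance the edges met against a potential of the last two positions of
   the front: on a side an edge is gained per step on average, in a corner three
   edges, up to the change in potential, and the potential is back at its
   starting value after a full turn.  Edges are counted twice, as total weight
   of the windows (those overhanging the border included): an orthogonal edge
   lies in two windows, a diagonal one in a single window and gets weight two.

   Lower bound.  Run along the rows of even index, alternately rightwards and
   leftwards, each time leaving out the end cell of the row so as to step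
   diagonally into a single cell of the row of odd index. *)

Set Implicit Arguments.
Unset Strict Implicit.
Unset Printing Implicit Defensive.

(* The preprocessing of lia enters the bodies of big operators, after which
   equal sums are not recognised as equal any more. *)
Ltac sum_lia :=
  repeat match goal with |- context [@bigop.body ?R ?I ?x ?r ?f] =>
    generalize (@bigop.body R I x r f); intro end;
  lia.

(** * Peeling off a frame *)

Definition win_count (a b c d : bool) : nat := a + b + c + d.

(* The window with rows [a b] and [c d]. *)
Definition win_weight (a b c d : bool) : nat :=
  a * b + c * d + a * c + b * d + 2 * (a * d) + 2 * (b * c).

(* The potential of two consecutive triples of cells across the strip, each
   coded in binary with the cell nearest the border as lowest bit.  The values
   are the greatest excess of weight over a walk ending in the given position,
   that is, longest path lengths in the finite graph of positions whose steps
   are those of [side_check] and [corner_check]; that this graph has no cycle of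
   positive excess is what makes the proof work.  Entries for impossible
   positions are 0. *)
Definition pot_table : seq (seq nat) :=
  [:: [:: 0; 0; 0; 1; 0; 0; 1; 2];
      [:: 0; 2; 2; 0; 0; 2; 3; 0];
      [:: 2; 2; 2; 0; 2; 2; 0; 0];
      [:: 2; 0; 0; 0; 2; 0; 0; 0];
      [:: 0; 0; 2; 3; 0; 0; 0; 0];
      [:: 0; 2; 4; 0; 0; 2; 0; 0];
      [:: 2; 2; 0; 0; 0; 0; 0; 0];
      [:: 2; 0; 0; 0; 0; 0; 0; 0]].

Definition pot (a1 a2 a3 b1 b2 b3 : bool) : nat :=
  nth 0 (nth [::] pot_table (a1 + 2 * a2 + 4 * a3)) (b1 + 2 * b2 + 4 * b3).

(** The strip moves from (a, b) to (b, c), index 1 being nearest the border. The 2 is the weight of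
    one edge; the edge from [b3] to [c3] belongs to the inner board and is granted as extra. *)
Lemma side_check (a1 a2 a3 b1 b2 b3 c1 c2 c3 : bool) :
  win_count a1 b1 a2 b2 <= 2 -> win_count a2 b2 a3 b3 <= 2 ->
  win_count b1 c1 b2 c2 <= 2 -> win_count b2 c2 b3 c3 <= 2 ->
  (b2 -> a1 + b1 + c1 + a2 + c2 + a3 + b3 + c3 <= 2) ->
  win_weight false false b1 c1 + win_weight b1 c1 b2 c2
    + win_weight b2 c2 b3 c3 + pot a1 a2 a3 b1 b2 b3
  <= b3 * c3 + 2 + pot b1 b2 b3 c1 c2 c3.
Proof.
case: a1 a2 b1 b2 => [] [] [] [] //; case: a3 b3 => [] [] //;
  by case: c1 c2 c3 => [] [] [] // ? ? ? ? /(_ isT).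
Qed.

(** The strip turns around the corner cell [p11], arriving on rows 4 and 3 and leaving on columns 2
    and 3. The 6 is the weight of three edges. *)
Lemma corner_check (p11 p12 p13 p21 p22 p23 p31 p32 p33 p41 p42 p43 : bool) :
  win_count p11 p12 p21 p22 <= 2 -> win_count p12 p13 p22 p23 <= 2 ->
  win_count p21 p22 p31 p32 <= 2 -> win_count p22 p23 p32 p33 <= 2 ->
  win_count p31 p32 p41 p42 <= 2 -> win_count p32 p33 p42 p43 <= 2 ->
  (p22 -> p11 + p12 + p13 + p21 + p23 + p31 + p32 + p33 <= 2) ->
  (p32 -> p21 + p22 + p23 + p31 + p33 + p41 + p42 + p43 <= 2) ->
  win_weight false false false p11 + win_weight false false p11 p12
    + win_weight false false p12 p13
    + (win_weight false p11 false p21 + win_weight p11 p12 p21 p22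
       + win_weight p12 p13 p22 p23)
    + (win_weight false p21 false p31 + win_weight p21 p22 p31 p32
       + win_weight p22 p23 p32 p33) + pot p41 p42 p43 p31 p32 p33
  <= 6 + pot p12 p22 p32 p13 p23 p33.
Proof.
case: p11 p12 p21 p22 => [] [] [] [] //; case: p13 p23 => [] [] //;
  case: p31 p32 => [] [] //; case: p33 => //; case: p41 p42 => [] [] //;
  by case: p43 => // ? ? ? ? ? ? h1 h2; move: (h1 isT) || move: (h2 isT).
Qed.

Section Peeling.
Implicit Types (F : nat -> nat -> bool) (N : nat).

Definition cell_deg F i j : nat :=
  F i.-1 j.-1 + F i.-1 j + F i.-1 j.+1 + F i j.-1 + F i j.+1
  + F i.+1 j.-1 + F i.+1 j + F i.+1 j.+1.

(* The board of side n is placed at the indices 1, ..., n = N - 1, so that the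
   windows overhanging its border have indices in nat too. *)
Definition legal N F : Prop :=
  [/\ forall i j, F i j -> (0 < i < N) && (0 < j < N),
      forall i j, win_count (F i j) (F i j.+1) (F i.+1 j) (F i.+1 j.+1) <= 2
    & forall i j, F i j -> cell_deg F i j <= 2].

Definition wt F i j : nat :=
  win_weight (F i j) (F i j.+1) (F i.+1 j) (F i.+1 j.+1).

Definition win_sum N F : nat := \sum_(i < N) \sum_(j < N) wt F i j.

(* A quarter turn. *)
Definition turn N F i j : bool := F j (N - i).

Lemma legal_row0 N F i j : legal N F -> i = 0 -> F i j = false.
Proof. by case=> sF _ _ ->; apply/negP => /sF. Qed.

Lemma legal_col0 N F i j : legal N F -> j = 0 -> F i j = false.
Proof. by case=> sF _ _ ->; apply/negP => /sF /andP[]. Qed.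

Lemma legal_turn N F : legal N F -> legal N (turn N F).
Proof.
move=> lF; have [sF wF dF] := lF; split; rewrite /turn.
- by move=> i j /sF; lia.
- move=> i j; case: (ltnP i N) => iN.
    have -> : N - i = (N - i.+1).+1 by lia.
    by move: (wF j (N - i.+1)); rewrite /win_count; lia.
  (* Beyond the board [N - i] truncates to 0, and column 0 is empty. *)
  by rewrite /win_count !(legal_col0 _ lF) //; lia.
- move=> i j Fij; have iN := sF _ _ Fij.
  move: Fij (dF j (N - i)) => -> /(_ isT).
  rewrite /cell_deg /=.
  have -> : N - i.-1 = (N - i).+1 by lia.
  have -> : N - i.+1 = (N - i).-1 by lia.
  lia.
Qed.

Lemma wt_turn N F i j : i < N -> wt (turn N F) i j = wt F j (N.-1 - i).
Proof.
move=> iN; rewrite /wt /turn /win_weight.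
have -> : N - i = (N.-1 - i).+1 by lia.
have -> : N - i.+1 = N.-1 - i by lia.
lia.
Qed.

(** * The walk around the frame *)

Definition side_sum M F : nat :=
  \sum_(j < M) (wt F 0 j.+3 + wt F 1 j.+3 + wt F 2 j.+3).

Definition corner_sum F : nat :=
  wt F 0 0 + wt F 0 1 + wt F 0 2 + (wt F 1 0 + wt F 1 1 + wt F 1 2)
  + (wt F 2 0 + wt F 2 1 + wt F 2 2).

(* Edges along the border of the inner board: they do not touch the frame, but
   each lies in one of the windows of [side_sum]. *)
Definition inner_side M F : nat := \sum_(j < M) F 3 j.+3 * F 3 j.+4.

Definition side_pot F j : nat :=
  pot (F 1 j) (F 2 j) (F 3 j) (F 1 j.+1) (F 2 j.+1) (F 3 j.+1).

(* The strip arrives at the corner from below, moving up along the left side. *)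
Definition corner_pot F : nat :=
  pot (F 4 1) (F 4 2) (F 4 3) (F 3 1) (F 3 2) (F 3 3).

Lemma side_step N F j : legal N F ->
  wt F 0 j.+1 + wt F 1 j.+1 + wt F 2 j.+1 + side_pot F j
    <= F 3 j.+1 * F 3 j.+2 + 2 + side_pot F j.+1.
Proof.
move=> lF; have [_ wF dF] := lF.
rewrite /wt !(@legal_row0 N F 0) //.
apply: side_check; [exact: wF..|exact: dF].
Qed.

Lemma side_le N M F : legal N F ->
  side_sum M F + side_pot F 2 <= inner_side M F + 2 * M + side_pot F M.+2.
Proof.
move=> lF; rewrite /side_sum /inner_side.
elim: M => [|M IH]; first by rewrite !big_ord0.
by rewrite !big_ord_recr; move: (side_step M.+2 lF) IH => /=; sum_lia.
Qed.

Lemma corner_le N F :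
  legal N F -> corner_sum F + corner_pot F <= 6 + side_pot F 2.
Proof.
move=> lF; have [_ wF dF] := lF.
rewrite /corner_sum /wt !(@legal_row0 N F 0) // !(@legal_col0 N F _ 0) //.
apply: corner_check; [exact: wF..|exact: dF|exact: dF].
Qed.

(** The potentials telescope along the side, and its end position is the arrival position at the
    next corner, seen after a quarter turn. *)
Lemma corner_side_le M F : legal M.+3.+3 F ->
  corner_sum F + side_sum M F + corner_pot F
    <= inner_side M F + 2 * M + 6 + corner_pot (turn M.+3.+3 F).
Proof.
move=> lF; have -> : corner_pot (turn M.+3.+3 F) = side_pot F M.+2.
  rewrite /corner_pot /side_pot /turn.
  by have [-> ->] : M.+3.+3 - 4 = M.+2 /\ M.+3.+3 - 3 = M.+3 by lia.
by move: (side_le M lF) (corner_le lF); lia.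
Qed.

Lemma big_ord_shift (x : nat -> nat) M :
  \sum_(i < M.+1) x i = x 0 + \sum_(i < M) x i.+1.
Proof. exact: big_ord_recl. Qed.

Lemma big_ord_split33 (x : nat -> nat) M :
  \sum_(i < M.+3.+3) x i = x 0 + x 1 + x 2 + \sum_(i < M) x i.+3
    + x M.+3 + x M.+4 + x M.+3.+2.
Proof.
rewrite 3!big_ord_recr /= (big_ord_shift x) (big_ord_shift (fun i => x i.+1)).
by rewrite (big_ord_shift (fun i => x i.+2)) !addnA.
Qed.

Lemma big_ord_split11 (x : nat -> nat) M :
  \sum_(i < M.+2) x i = x 0 + \sum_(i < M) x i.+1 + x M.+1.
Proof. by rewrite big_ord_recr /= big_ord_shift. Qed.

Lemma big_ord_rev (x : nat -> nat) M :
  \sum_(i < M) x i = \sum_(i < M) x (M - i.+1).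
Proof. by rewrite (reindex_inj rev_ord_inj). Qed.

(** A corner and the side after it form a rectangle of 3 by [M.+3] windows; four of these surround
    the central block like a pinwheel. *)
Lemma win_sum_split M F (N := M.+3.+3) :
  win_sum N F = corner_sum F + side_sum M F
    + (corner_sum (turn N F) + side_sum M (turn N F))
    + (corner_sum (turn N (turn N F)) + side_sum M (turn N (turn N F)))
    + (corner_sum (turn N (turn N (turn N F)))
       + side_sum M (turn N (turn N (turn N F))))
    + \sum_(i < M) \sum_(j < M) wt F i.+3 j.+3.
Proof.
rewrite /win_sum (big_ord_split33 (fun i => \sum_(j < N) wt F i j)).
have -> : \sum_(i < M) \sum_(j < N) wt F i.+3 j
    = \sum_(i < M) wt F i.+3 0 + \sum_(i < M) wt F i.+3 1
      + \sum_(i < M) wt F i.+3 2 + \sum_(i < M) \sum_(j < M) wt F i.+3 j.+3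
      + \sum_(i < M) wt F i.+3 M.+3 + \sum_(i < M) wt F i.+3 M.+4
      + \sum_(i < M) wt F i.+3 M.+3.+2.
  by rewrite -!big_split; apply: eq_bigr => i _; exact: big_ord_split33.
rewrite (big_ord_split33 (wt F 0)) (big_ord_split33 (wt F 1)).
rewrite (big_ord_split33 (wt F 2)) (big_ord_split33 (wt F M.+3)).
rewrite (big_ord_split33 (wt F M.+4)) (big_ord_split33 (wt F M.+3.+2)).
have -> : side_sum M (turn N F)
    = \sum_(i < M) wt F i.+3 M.+3 + \sum_(i < M) wt F i.+3 M.+4
      + \sum_(i < M) wt F i.+3 M.+3.+2.
  rewrite -!big_split; apply: eq_bigr => i _ /=; rewrite !wt_turn //.
  by rewrite /N /= subn0 subn1 subn2 /=; lia.
have -> : side_sum M (turn N (turn N F))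
    = \sum_(i < M) wt F M.+3 i.+3 + \sum_(i < M) wt F M.+4 i.+3
      + \sum_(i < M) wt F M.+3.+2 i.+3.
  rewrite (big_ord_rev (fun i => wt F M.+3 i.+3)).
  rewrite (big_ord_rev (fun i => wt F M.+4 i.+3)).
  rewrite (big_ord_rev (fun i => wt F M.+3.+2 i.+3)).
  rewrite -!big_split; apply: eq_bigr => i _ /=; have iM := ltn_ord i.
  rewrite !wt_turn //; try by rewrite /N; lia.
  rewrite /N /= subn0 subn1 subn2 /=.
  have -> : M.+3.+2 - i.+3 = (M - i.+1).+3 by lia.
  lia.
have -> : side_sum M (turn N (turn N (turn N F)))
    = \sum_(i < M) wt F i.+3 0 + \sum_(i < M) wt F i.+3 1
      + \sum_(i < M) wt F i.+3 2.
  rewrite (big_ord_rev (fun i => wt F i.+3 0)).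
  rewrite (big_ord_rev (fun i => wt F i.+3 1)).
  rewrite (big_ord_rev (fun i => wt F i.+3 2)).
  rewrite -!big_split; apply: eq_bigr => i _ /=; have iM := ltn_ord i.
  rewrite !wt_turn //; try by rewrite /N; lia.
  rewrite /N /= subn0 subn1 subn2 /=.
  have -> : M.+3.+2 - i.+3 = (M - i.+1).+3 by lia.
  have [-> -> ->] : [/\ M.+3.+2 - M.+3.+2 = 0, M.+3.+2 - M.+4 = 1
    & M.+3.+2 - M.+3 = 2] by split; lia.
  lia.
have -> : side_sum M F = \sum_(i < M) wt F 0 i.+3 + \sum_(i < M) wt F 1 i.+3
    + \sum_(i < M) wt F 2 i.+3.
  by rewrite -!big_split.
rewrite /corner_sum.
rewrite !wt_turn //; try by rewrite /N; lia.
rewrite /N /= ?subn0 ?subn1 ?subn2 /=.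
have [-> -> ->] : [/\ M.+3.+2 - M.+3.+2 = 0, M.+3.+2 - M.+4 = 1
    & M.+3.+2 - M.+3 = 2] by split; lia.
sum_lia.
Qed.

Definition inner M F i j : bool :=
  [&& 0 < i < M.+2, 0 < j < M.+2 & F i.+2 j.+2].

Lemma legal_inner M F : legal M.+3.+3 F -> legal M.+2 (inner M F).
Proof.
case=> sF wF dF.
have le_in i j : inner M F i j <= F i.+2 j.+2.
  by rewrite /inner; case: (F _ _); rewrite ?leq_b1 // !andbF.
split.
- by move=> i j /and3P[-> ->].
- move=> i j; apply: leq_trans (wF i.+2 j.+2).
  by rewrite /win_count; do ![exact: le_in | apply: leq_add].
- move=> i j /and3P[iM jM Fij]; apply: leq_trans (dF _ _ Fij).
  case: i j iM jM {Fij} => [|i] [|j] // _ _.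
  by rewrite /cell_deg /=; do ![exact: le_in | apply: leq_add].
Qed.

Lemma innerE M F i j : i <= M -> j <= M -> inner M F i.+1 j.+1 = F i.+3 j.+3.
Proof. by rewrite /inner !ltnS => -> ->. Qed.

Lemma win_weight_ge (a b c d : bool) :
  [/\ a * b <= win_weight a b c d, c * d <= win_weight a b c d,
      a * c <= win_weight a b c d & b * d <= win_weight a b c d].
Proof. by case: a b c d => [] [] [] []. Qed.

(** The central windows are those of the inner board that do not overhang its border. The
    overhanging ones contain the border edges once more and so pay for [inner_side]. *)
Lemma win_sum_inner M F (N := M.+3.+3) :
  inner_side M F + inner_side M (turn N F) + inner_side M (turn N (turn N F))
    + inner_side M (turn N (turn N (turn N F)))
    + \sum_(i < M) \sum_(j < M) wt F i.+3 j.+3 <= win_sum M.+2 (inner M F).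
Proof.
set G := inner M F.
rewrite /win_sum (big_ord_split11 (fun i => \sum_(j < M.+2) wt G i j)).
have -> : \sum_(i < M) \sum_(j < M.+2) wt G i.+1 j
    = \sum_(i < M) wt G i.+1 0 + \sum_(i < M) \sum_(j < M) wt G i.+1 j.+1
      + \sum_(i < M) wt G i.+1 M.+1.
  by rewrite -!big_split; apply: eq_bigr => i _; exact: big_ord_split11.
rewrite (big_ord_split11 (wt G 0)) (big_ord_split11 (wt G M.+1)).
have -> : \sum_(i < M) \sum_(j < M) wt F i.+3 j.+3
    = \sum_(i < M) \sum_(j < M) wt G i.+1 j.+1.
  apply: eq_bigr => i _; apply: eq_bigr => j _.
  by rewrite /wt /G !innerE // ltnW.
have h1 : inner_side M F <= \sum_(j < M) wt G 0 j.+1.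
  apply: leq_sum => j _; have jM := ltn_ord j.
  rewrite /wt /G (@innerE _ _ _ j) 1?(ltnW jM) // (@innerE _ _ _ j.+1) //.
  by case: (win_weight_ge (inner M F 0 j.+1) (inner M F 0 j.+2)
    (F 3 j.+3) (F 3 j.+4)).
have h2 : inner_side M (turn N F) <= \sum_(i < M) wt G i.+1 M.+1.
  apply: leq_sum => j _; have jM := ltn_ord j; rewrite /turn.
  have -> : N - 3 = M.+3 by rewrite /N; lia.
  rewrite /wt /G (@innerE _ _ j) ?(ltnW jM) // (@innerE _ _ j.+1) //.
  by case: (win_weight_ge (F j.+3 M.+3) (inner M F j.+1 M.+2)
    (F j.+4 M.+3) (inner M F j.+2 M.+2)).
have h3 : inner_side M (turn N (turn N F)) <= \sum_(j < M) wt G M.+1 j.+1.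
  rewrite (big_ord_rev (fun j => wt G M.+1 j.+1)).
  apply: leq_sum => j _; have jM := ltn_ord j; rewrite /turn.
  have -> : N - 3 = M.+3 by rewrite /N; lia.
  have -> : N - j.+3 = (M - j.+1).+4 by rewrite /N; lia.
  have -> : N - j.+4 = (M - j.+1).+3 by rewrite /N; lia.
  set k := M - j.+1; have kM : k < M by rewrite /k; lia.
  rewrite mulnC /wt /G (@innerE _ _ _ k) ?(ltnW kM) // (@innerE _ _ _ k.+1) //.
  by case: (win_weight_ge (F M.+3 k.+3) (F M.+3 k.+4)
    (inner M F M.+2 k.+1) (inner M F M.+2 k.+2)).
have h4 : inner_side M (turn N (turn N (turn N F))) <= \sum_(i < M) wt G i.+1 0.
  rewrite (big_ord_rev (fun j => wt G j.+1 0)).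
  apply: leq_sum => j _; have jM := ltn_ord j; rewrite /turn.
  have -> : N - (N - 3) = 3 by rewrite /N; lia.
  have -> : N - j.+3 = (M - j.+1).+4 by rewrite /N; lia.
  have -> : N - j.+4 = (M - j.+1).+3 by rewrite /N; lia.
  set k := M - j.+1; have kM : k < M by rewrite /k; lia.
  rewrite mulnC /wt /G (@innerE _ _ k) ?(ltnW kM) // (@innerE _ _ k.+1) //.
  by case: (win_weight_ge (inner M F k.+1 0) (F k.+3 3)
    (inner M F k.+2 0) (F k.+4 3)).
move: h1 h2 h3 h4; sum_lia.
Qed.

Lemma win_sum_peel M F : legal M.+3.+3 F ->
  win_sum M.+3.+3 F <= win_sum M.+2 (inner M F) + 8 * M + 24.
Proof.
move=> l0; have l1 := legal_turn l0; have l2 := legal_turn l1.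
have l3 := legal_turn l2; have := corner_side_le l3.
pose N := M.+3.+3.
(* Four quarter turns restore the position, so all potentials cancel. *)
have -> : corner_pot (turn N (turn N (turn N (turn N F)))) = corner_pot F.
  by rewrite /corner_pot /turn !subKn.
rewrite win_sum_split; move: (win_sum_inner M F).
move: (corner_side_le l0) (corner_side_le l1) (corner_side_le l2).
sum_lia.
Qed.

(** * Small boards and the induction *)

Lemma win_sum2 F : legal 2 F -> win_sum 2 F = 0.
Proof.
move=> lF; have [sF _ _] := lF.
have F2 i : F i 2 = false by apply/negP => /sF; rewrite andbF.
have F2' i : F 2 i = false by apply/negP => /sF; rewrite andbF.
rewrite /win_sum !big_ord_recl !big_ord0 /= /wt /bump /=.
rewrite !(@legal_row0 2 F 0) // !(@legal_col0 2 F _ 0) // !F2 !F2'.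
by rewrite /win_weight; lia.
Qed.

Lemma win_sum4 F : legal 4 F -> win_sum 4 F <= 8.
Proof.
move=> lF; have [sF wF dF] := lF.
have F4 i : F i 4 = false by apply/negP => /sF; rewrite andbF.
have F4' i : F 4 i = false by apply/negP => /sF; rewrite andbF.
rewrite /win_sum !big_ord_recl !big_ord0 /= /wt /bump /=.
rewrite !(@legal_row0 4 F 0) // !(@legal_col0 4 F _ 0) // !F4 !F4'.
move: (wF 1 1) (wF 1 2) (wF 2 1) (wF 2 2) (dF 2 2).
rewrite /cell_deg /=.
case: (F 1 1) (F 1 2) (F 2 1) (F 2 2) => [] [] [] [] //;
case: (F 1 3) (F 2 3) => [] [] //; case: (F 3 1) (F 3 2) => [] [] //;
by case: (F 3 3) => // ? ? ? ? /(_ isT).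
Qed.

Lemma win_sum_le k F : legal k.*2.+2 F -> win_sum k.*2.+2 F <= 4 * k * k.+1.
Proof.
elim: k {-2}k (leqnn k) F => [|m IH] [|[|k]] // km F lF.
- by rewrite win_sum2.
- by rewrite win_sum2.
- exact: win_sum4.
- have lF' : legal k.*2.+3.+3 F by [].
  (* The increment fits exactly: 4(k+2)(k+3) - 4k(k+1) = 16k + 24, which is 8M + 24 for M = 2k. *)
  have := IH k (ltnW km) _ (legal_inner lF').
  by move: (win_sum_peel lF'); rewrite !doubleS; set s := win_sum _ F; lia.
Qed.

End Peeling.

(** * From snake paths to sets of cells *)

Section SnakeIndices.
Variables (T : eqType) (adj : rel T).
Implicit Type s : seq T.

Lemma path_length_size s : path_length s = (size s).-1.
Proof. by rewrite /path_length /path_edges size_zip size_behead; lia. Qed.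

Lemma mem_path_edges x0 s p q : uniq s -> p < size s -> q < size s ->
  ((nth x0 s p, nth x0 s q) \in path_edges s) = (q == p.+1).
Proof.
move=> Us ps qs; rewrite /path_edges; have sz := path_length_size s.
rewrite /path_length /path_edges in sz.
apply/idP/eqP => [/(nthP (x0, x0))[r]|def_q].
  rewrite nth_zip_cond sz => rs; rewrite rs nth_behead.
  by case=> /eqP + /eqP; rewrite !nth_uniq //; lia.
apply/(nthP (x0, x0)); exists p; rewrite ?nth_zip_cond sz; first by lia.
by rewrite nth_behead -def_q; case: ifP => //; lia.
Qed.

Lemma snake_pathP x0 s : 0 < size s -> symmetric adj ->
  snake_path adj s <-> uniq s /\ forall p q, p < size s -> q < size s ->
    adj (nth x0 s p) (nth x0 s q) = (q == p.+1) || (p == q.+1).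
Proof.
move=> s_gt0 adjC; split=> [[s_path s_ind]|[Us s_ind]].
  have Us : uniq s by case: (s) s_path => // x s' /andP[].
  split=> // p q ps qs; rewrite s_ind ?mem_nth // /path_adj /=.
  by rewrite !mem_path_edges.
split.
  case: s s_gt0 Us s_ind => // x s' _ Us s_ind; rewrite /is_path Us andbT.
  apply/(pathP x0) => i i_lt.
  by have := s_ind i i.+1 (ltnW i_lt) i_lt; rewrite eqxx.
move=> u v /(nthP x0)[p ps <-] /(nthP x0)[q qs <-].
by rewrite s_ind // /path_adj /= !mem_path_edges.
Qed.

End SnakeIndices.

(** * Degree sums as sums over windows *)

Section DegreeSum.
Variables (n : nat) (F : nat -> nat -> bool).
Hypothesis lF : legal n.+1 F.

Let F0l j : F 0 j = false. Proof. exact: legal_row0 lF _. Qed.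
Let F0r i : F i 0 = false. Proof. exact: legal_col0 lF _. Qed.
Let Fnl j : F n.+1 j = false.
Proof. by case: lF => sF _ _; apply/negP => /sF; rewrite ltnn andbF. Qed.
Let Fnr i : F i n.+1 = false.
Proof. by case: lF => sF _ _; apply/negP => /sF; rewrite ltnn !andbF. Qed.

Lemma sum_drop_last (x : nat -> nat) : x n = 0 ->
  \sum_(i < n.+1) x i = \sum_(i < n) x i.
Proof. by move=> xn; rewrite big_ord_recr /= xn addn0. Qed.

Lemma sum_drop_first (x : nat -> nat) : x 0 = 0 ->
  \sum_(i < n.+1) x i = \sum_(i < n) x i.+1.
Proof. by move=> x0; rewrite big_ord_shift x0. Qed.

Lemma sum_cell_deg :
  \sum_(i < n) \sum_(j < n) F i.+1 j.+1 * cell_deg F i.+1 j.+1 = win_sum n.+1 F.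
Proof.
(* An edge of a window is shared out between its two end cells: a, b, c, d are
   twice the shares of the four cells of the window. *)
pose a i j := F i j * (F i j.+1 + F i.+1 j + 2 * F i.+1 j.+1).
pose b i j := F i j.+1 * (F i j + F i.+1 j.+1 + 2 * F i.+1 j).
pose c i j := F i.+1 j * (F i j + F i.+1 j.+1 + 2 * F i j.+1).
pose d i j := F i.+1 j.+1 * (F i j.+1 + F i.+1 j + 2 * F i j).
(* Each of the four sums is reindexed by cell instead of by window; the terms dropped belong to
   cells off the board. *)
have sa : \sum_(i < n.+1) \sum_(j < n.+1) a i j
    = \sum_(i < n) \sum_(j < n) a i.+1 j.+1.
  rewrite (sum_drop_first (x := fun i => \sum_(j < n.+1) a i j)).
    by apply: eq_bigr => i _; rewrite sum_drop_first // /a F0r.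
  by rewrite big1 // => j _; rewrite /a F0l.
have sb : \sum_(i < n.+1) \sum_(j < n.+1) b i j
    = \sum_(i < n) \sum_(j < n) b i.+1 j.
  rewrite (sum_drop_first (x := fun i => \sum_(j < n.+1) b i j)).
    by apply: eq_bigr => i _; rewrite sum_drop_last // /b Fnr.
  by rewrite big1 // => j _; rewrite /b F0l.
have sc : \sum_(i < n.+1) \sum_(j < n.+1) c i j
    = \sum_(i < n) \sum_(j < n) c i j.+1.
  rewrite (sum_drop_last (x := fun i => \sum_(j < n.+1) c i j)).
    by apply: eq_bigr => i _; rewrite sum_drop_first // /c F0r.
  by rewrite big1 // => j _; rewrite /c Fnl.
have sd : \sum_(i < n.+1) \sum_(j < n.+1) d i j
    = \sum_(i < n) \sum_(j < n) d i j.
  rewrite (sum_drop_last (x := fun i => \sum_(j < n.+1) d i j)).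
    by apply: eq_bigr => i _; rewrite sum_drop_last // /d Fnr.
  by rewrite big1 // => j _; rewrite /d Fnl.
apply/eqP; rewrite -(eqn_pmul2l (ltn0Sn 1)); apply/eqP.
transitivity (\sum_(i < n.+1) \sum_(j < n.+1) a i j
  + \sum_(i < n.+1) \sum_(j < n.+1) b i j
  + \sum_(i < n.+1) \sum_(j < n.+1) c i j
  + \sum_(i < n.+1) \sum_(j < n.+1) d i j).
  rewrite sa sb sc sd big_distrr -!big_split; apply: eq_bigr => i _.
  rewrite big_distrr -!big_split; apply: eq_bigr => j _ /=.
  rewrite /a /b /c /d /cell_deg /=; lia.
rewrite /win_sum big_distrr -!big_split; apply: eq_bigr => i _.
rewrite big_distrr -!big_split; apply: eq_bigr => j _ /=.
rewrite /a /b /c /d /wt /win_weight; lia.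
Qed.

End DegreeSum.

(** * The cells of a snake as a board *)

Section SnakeGrid.
Variables (n : nat) (s : seq ('I_n * 'I_n)) (x0 : 'I_n * 'I_n).
Hypotheses (Us : uniq s)
  (s_ind : forall p q, p < size s -> q < size s ->
     king n (nth x0 s p) (nth x0 s q) = (q == p.+1) || (p == q.+1)).

Definition shift_cell (u : 'I_n * 'I_n) : nat * nat := (u.1.+1, u.2.+1).

Definition grid : seq (nat * nat) := map shift_cell s.

Definition in_grid i j : bool := (i, j) \in grid.

Definition nbrs (u : nat * nat) : seq (nat * nat) :=
  let: (i, j) := u in
  [:: (i.-1, j.-1); (i.-1, j); (i.-1, j.+1); (i, j.-1); (i, j.+1);
      (i.+1, j.-1); (i.+1, j); (i.+1, j.+1)].

Lemma cell_degE i j : cell_deg in_grid i j = count (mem grid) (nbrs (i, j)).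
Proof. by rewrite /cell_deg /= -!/(in_grid _ _); lia. Qed.

Lemma shift_cell_inj : injective shift_cell.
Proof. by move=> [i j] [i' j'] [/val_inj -> /val_inj ->]. Qed.

Lemma king_nbrs u v : king n u v = (shift_cell v \in nbrs (shift_cell u)).
Proof.
case: u v => [i j] [i' j']; rewrite /king /= !inE !xpair_eqE /=.
rewrite -(inj_eq val_inj i) -(inj_eq val_inj j) /=; lia.
Qed.

Lemma uniq_nbrs u : uniq (nbrs (shift_cell u)).
Proof. by case: u => i j; rewrite /= !inE !xpair_eqE /=; lia. Qed.

Let x1 := shift_cell x0.

Lemma nth_grid p : p < size s -> nth x1 grid p = shift_cell (nth x0 s p).
Proof. by move=> ps; rewrite (nth_map x0). Qed.

Lemma nbrs_grid p q : p < size s -> q < size s ->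
  (nth x1 grid q \in nbrs (nth x1 grid p)) = (q == p.+1) || (p == q.+1).
Proof. by move=> ps qs; rewrite !nth_grid // -king_nbrs s_ind. Qed.

Lemma uniq_grid : uniq grid.
Proof. by rewrite map_inj_uniq //; exact: shift_cell_inj. Qed.

Lemma gridP u :
  reflect (exists2 p, p < size s & nth x1 grid p = u) (u \in grid).
Proof. by apply: (iffP (nthP x1)); rewrite size_map. Qed.

Lemma deg_grid_le u : u \in grid -> count (mem grid) (nbrs u) <= 2.
Proof.
case/gridP=> p ps <-; rewrite -size_filter.
apply: (@uniq_leq_size _ _ [:: nth x1 grid p.-1; nth x1 grid p.+1]).
  by rewrite filter_uniq // nth_grid // uniq_nbrs.
move=> v; rewrite mem_filter => /andP[/gridP[q qs <-]].
rewrite nbrs_grid // => /orP[/eqP->|/eqP->]; rewrite !inE eqxx ?orbT //.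
Qed.

Lemma deg_grid_ge p : p < size s ->
  (0 < p) + (p.+1 < size s) <= count (mem grid) (nbrs (nth x1 grid p)).
Proof.
move=> ps; rewrite -size_filter.
pose l := [seq nth x1 grid q | q <- [seq q <- iota 0 (size s)
                                      | (q == p.+1) || (p == q.+1)]].
apply: (@leq_trans (size l)).
  pose l' := (if 0 < p then [:: p.-1] else [::])
    ++ if p.+1 < size s then [:: p.+1] else [::].
  rewrite size_map; apply: (@leq_trans (size l')).
    by rewrite size_cat; case: ifP; case: ifP.
  rewrite {}/l'; apply: uniq_leq_size.
    by case: ifP; case: ifP => //=; rewrite !inE; lia.
  move=> q; rewrite mem_cat mem_filter mem_iota.
  by case: ifP; case: ifP; rewrite ?in_nil ?mem_seq1 ?mem_seq1; lia.
apply: uniq_leq_size.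
  rewrite map_inj_in_uniq ?filter_uniq ?iota_uniq // => q r.
  rewrite !mem_filter !mem_iota => /andP[_ qs] /andP[_ rs] /eqP.
  by rewrite nth_uniq ?size_map ?uniq_grid // => /eqP.
move=> v /mapP[q]; rewrite mem_filter mem_iota add0n => /andP[qp qs] ->.
by rewrite mem_filter nbrs_grid // qp andbT; apply: mem_nth; rewrite size_map.
Qed.

(** Three indices cannot be pairwise consecutive. Since the cells of a window are pairwise adjacent,
    this limits a window to two cells. *)
Lemma no_triangle u v w : u \in grid -> v \in grid -> w \in grid ->
  v \in nbrs u -> w \in nbrs v -> w \in nbrs u -> False.
Proof.
case/gridP=> p ps <- /gridP[q qs <-] /gridP[r rs <-].
rewrite !nbrs_grid //; lia.
Qed.

Lemma legal_grid : legal n.+1 in_grid.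
Proof.
split=> [i j /mapP[u _ [-> ->]]|i j|i j ij]; first by rewrite !ltnS !ltn_ord.
  rewrite leqNgt; apply/negP; rewrite /win_count /in_grid.
  have [a|_] := boolP ((i, j) \in _); have [b|_] := boolP ((i, j.+1) \in _);
  have [c|_] := boolP ((i.+1, j) \in _);
  have [d|_] := boolP ((i.+1, j.+1) \in _) => // _.
  - by apply: (no_triangle a b c); rewrite !inE !xpair_eqE; lia.
  - by apply: (no_triangle a b c); rewrite !inE !xpair_eqE; lia.
  - by apply: (no_triangle a b d); rewrite !inE !xpair_eqE; lia.
  - by apply: (no_triangle a c d); rewrite !inE !xpair_eqE; lia.
  - by apply: (no_triangle b c d); rewrite !inE !xpair_eqE; lia.
by rewrite cell_degE; apply: deg_grid_le.
Qed.

(** Counting the predecessor and the successor of each position gives twice the length; as no cell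
    repeats, the sum over positions is a sum over cells. *)
Lemma size_le_win_sum : 2 * (size s).-1 <= win_sum n.+1 in_grid.
Proof.
have h : 2 * (size s).-1 = \sum_(p < size s) ((0 < p) + (p.+1 < size s)).
  rewrite big_split /=; case: (size s) => [|k]; first by rewrite !big_ord0.
  rewrite (big_ord_shift (fun p => 0 < p : nat)).
  rewrite [X in _ = _ + X]big_ord_recr /=.
  rewrite ltnn (eq_bigr (fun=> 1)) // sum1_card card_ord.
  rewrite (eq_bigr (fun=> 1)) => [|i _]; last by rewrite ltnS ltn_ord.
  by rewrite sum1_card card_ord; lia.
rewrite -(sum_cell_deg legal_grid) h.
apply: (@leq_trans (\sum_(p < size s) count (mem grid) (nbrs (nth x1 grid p)))).
  by apply: leq_sum => p _; apply: deg_grid_ge.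
pose deg u := count (mem grid) (nbrs u).
rewrite -(big_mkord xpredT (fun p => deg (nth x1 grid p))).
rewrite -(size_map shift_cell s) -(big_nth x1 xpredT deg) /deg.
rewrite big_map big_uniq //= pair_bigA /= big_mkcond /=.
apply: leq_sum => -[i j] _ /=; rewrite cell_degE.
rewrite /in_grid (mem_map shift_cell_inj s (i, j)).
by case: ifP; rewrite ?mul1n.
Qed.

End SnakeGrid.

(** * A snake along the rows *)

Lemma dist_le1 (a b : nat) : (`|a - b|%N <= 1) = (a <= b.+1) && (b <= a.+1).
Proof. by lia. Qed.

Section RowSnake.
Variable m : nat.
Let d := m.*2.

(* Position p = r d + q lies on row 2r, except that q = 0 is the connecting cell
   on row 2r - 1.  Truncation puts the first cell on row 0 and the minimum puts
   the last one on row d.  For m = 0 the only position is 0. *)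
Definition snake_row (p : nat) : nat :=
  if p %% d == 0 then minn (p %/ d).*2.-1 d else (p %/ d).*2.

Definition snake_col (p : nat) : nat :=
  if odd (p %/ d) then d - p %% d else p %% d.

Definition snake_cell (p : nat) : 'I_d.+1 * 'I_d.+1 :=
  (inord (snake_row p), inord (snake_col p)).

(** Each of the [m.+1] rows of even index accounts for [d] positions, and the final position closes
    the last row. *)
Definition row_snake : seq ('I_d.+1 * 'I_d.+1) :=
  mkseq snake_cell (d * m.+1).+1.

Lemma snake_cell_bound p :
  p <= d * m.+1 -> snake_row p <= d /\ snake_col p <= d.
Proof.
rewrite /snake_row /snake_col; case: (posnP m) => [m0|m_gt0].
  have d0 : d = 0 by rewrite /d m0.
  by rewrite d0 mul0n leqn0 => /eqP->; rewrite div0n.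
have d_gt0 : 0 < d by rewrite /d; lia.
have := divn_eq p d; have := ltn_pmod p d_gt0.
set r := p %/ d; set q := p %% d => qd p_eq p_le.
split; last by case: ifP => _; lia.
case: eqP => q0; first exact: geq_minr.
have : r * d < m.+1 * d by lia.
by rewrite ltn_mul2r d_gt0 /= /d; lia.
Qed.

Lemma king_snake_cell p q : p < q -> q <= d * m.+1 ->
  king d.+1 (snake_cell p) (snake_cell q) = (q == p.+1).
Proof.
move=> pq q_le.
have [pr pc] := snake_cell_bound (ltnW (leq_trans pq q_le)).
have [qr qc] := snake_cell_bound q_le.
rewrite /king /= /snake_cell xpair_eqE -!(inj_eq val_inj) /= !inordK //.
rewrite !dist_le1.
move: pr pc qr qc; rewrite /snake_row /snake_col.
have d_gt0 : 0 < d by case: (d) q_le pq => //; rewrite mul0n; lia.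
have d_ge2 : 2 <= d by move: d_gt0; rewrite /d; lia.
have := divn_eq p d; have := ltn_pmod p d_gt0.
have := divn_eq q d; have := ltn_pmod q d_gt0.
have : p %/ d <= q %/ d by apply: leq_div2r; apply: ltnW.
have : q %/ d <= m.+1 by rewrite -(mulKn m.+1 d_gt0) leq_div2r.
have : d = m.*2 by [].
move: (p %/ d) (p %% d) (q %/ d) (q %% d) => r j r' j'.
move: (d) q_le d_gt0 d_ge2 => e q_le e_gt0 e_ge2 eE r'm rr' j'e q_eq je p_eq.
have last_j' : r' = m.+1 -> j' = 0 by move=> r'E; move: q_eq; rewrite r'E; lia.
(* In equal blocks the columns decide. Blocks two or more apart have rows at distance at least two.
   Between consecutive blocks only the last cell of the first touches the connecting cell of the
   second. *)
case: (ltngtP r' r.+1) => [r'_lt|r'_gt|r'_eq].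
- have r'E : r' = r by lia.
  rewrite r'E in q_eq last_j' *; have jj' : j < j' by lia.
  have -> : (q == p.+1) = (j' == j.+1) by lia.
  have {last_j' r'm} r_le : r.*2.-1 <= e by lia.
  move=> _ _ _ _; rewrite (minn_idPl r_le) (_ : j' == 0 = false); last by lia.
  clear -j'e jj' e_ge2.
  by case: (odd r); case: (j =P 0) => j0; lia.
- have : r.+2 * e <= r' * e by rewrite leq_mul2r r'_gt orbT.
  rewrite !mulSn => r'e; move=> *.
  have -> : (q == p.+1) = false by apply/eqP; lia.
  apply/negP => /and3P[_ /andP[_ rows] _]; clear -rows r'm r'_gt eE.
  have row_p : (if j == 0 then minn r.*2.-1 e else r.*2) < r.*2.+1.
    by rewrite ltnS; case: ifP => _; rewrite ?geq_min ?leq_pred.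
  have row_q : r.*2.+1 < (if j' == 0 then minn r'.*2.-1 e else r'.*2).
    by case: ifP => _; rewrite ?leq_min; lia.
  by have := leq_trans row_q (leq_trans rows row_p); rewrite ltnn.
- rewrite r'_eq /= in q_eq last_j' r'm *; rewrite mulSn in q_eq.
  have -> : (q == p.+1) = (j' == 0) && (j == e.-1) by lia.
  move=> _ _ _ _; clear -j'e je eE e_ge2 r'm last_j'.
  have r_le : r.*2.-1 <= e by lia.
  have : r.*2 <= minn r.+1.*2.-1 e <= r.*2.+1 by rewrite leq_min geq_min; lia.
  rewrite (minn_idPl r_le); move: (minn _ _) => z zr.
  by case: (odd r) => /=; case: (j =P 0) => j0; case: (j' =P 0) => j'0; lia.
Qed.

Lemma king_sym n : symmetric (king n).
Proof.
by move=> u v; rewrite /king /= eq_sym distnC (distnC u.2).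
Qed.

Lemma king_irrefl n : irreflexive (king n).
Proof. by move=> u; rewrite /king /= eqxx. Qed.

(* Two equal cells on the snake would have the same neighbours, hence be at
   index distance two, which the neighbour on the far side of one of them rules
   out. *)
Lemma row_snake_uniq : uniq row_snake.
Proof.
apply/mkseq_uniqP.
suff neq p q : p < q -> q <= d * m.+1 -> snake_cell p <> snake_cell q.
  move=> p q /= p_lt q_lt pq; case: (ltngtP p q) => // lt.
    by case: (neq p q lt).
  by case: (neq q p lt).
move=> pq q_le eq_pq.
have adj r r' := @king_snake_cell r r'.
have [q_eq|q_neq] := eqVneq q p.+1.
  by have := adj p q pq q_le; rewrite eq_pq king_irrefl q_eq eqxx.
have p1q : p.+1 < q by lia.
have q_eq : q = p.+2.
  apply/eqP; rewrite -(adj p.+1 q) // -eq_pq king_sym adj ?eqxx //; lia.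
(* The snake is long enough that [p] and [p.+2] are not both its ends: there is a cell after [q] if
   p = 0, and one before [p] otherwise. *)
have bound_ge4 : 4 <= d * m.+1 by rewrite /d in q_le *; case: (m) q_le p1q; lia.
case: (posnP p) => [p0|p_gt0].
  have := adj q q.+1 (ltnSn q) ltac:(lia).
  by rewrite -eq_pq adj ?eqxx; lia.
have := adj p.-1 p ltac:(lia) ltac:(lia).
by rewrite eq_pq adj ?(ltn_predK p_gt0) ?eqxx; lia.
Qed.

Lemma row_snake_path : snake_path (king d.+1) row_snake.
Proof.
apply/(snake_pathP (snake_cell 0)); first by rewrite size_mkseq.
  exact: king_sym.
split=> [|p q]; first exact: row_snake_uniq.
rewrite !size_mkseq => p_lt q_lt; rewrite !nth_mkseq //.
case: (ltngtP p q) => [lt|lt|->].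
- by rewrite king_snake_cell //; lia.
- by rewrite king_sym king_snake_cell //; lia.
- by rewrite king_irrefl; lia.
Qed.

Lemma row_snake_length : path_length row_snake = d * m.+1.
Proof. by rewrite path_length_size size_mkseq. Qed.

End RowSnake.

(** * The greatest length *)

Lemma half_odd_square m : (m.*2.+1 ^ 2 - 1) %/ 2 = m.*2 * m.+1.
Proof.
by rewrite (_ : _ - 1 = 2 * (m.*2 * m.+1)) ?mulKn // -mulnn; lia.
Qed.

Theorem theorem2 (n : nat) (n_gt0 : 0 < n) (n_odd : odd n) :
  is_greatest
    (fun k : nat => exists s : seq ('I_n * 'I_n),
       snake_path (king n) s /\ path_length s = k)
    ((n ^ 2 - 1) %/ 2).
Proof.
move: n_odd; have [m def_n n_odd] : exists m, n = m.*2 + odd n.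
  by exists n./2; rewrite addnC odd_double_half.
rewrite n_odd addn1 in def_n; subst n; rewrite half_odd_square.
split=> [|k [s [s_snake <-]]].
  exists (row_snake m); split; first exact: row_snake_path.
  exact: row_snake_length.
have s_gt0 : 0 < size s by case: s s_snake => // -[].
pose x0 : 'I_m.*2.+1 * 'I_m.*2.+1 := (ord0, ord0).
have [Us s_ind] := (snake_pathP x0 s_gt0 (@king_sym _)).1 s_snake.
have := leq_trans (size_le_win_sum Us s_ind) (win_sum_le (legal_grid Us s_ind)).
by rewrite path_length_size; move: (size s).-1 => z; lia.
Qed.
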